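(* Let $\mathbb{F}$ be a field. (1) Let $r,s,\gamma\in\mathbb{F}$ and $v\in\mathbb{F}[h]$. Then the generalized down-up algebra $L(v,r,s,\gamma)$ is isomorphic to the quantum generalized Heisenberg algebra $\mathcal{H}_s(rh-\gamma,-v)$. In particular, the down-up algebra $A(\alpha,\beta,\gamma)$ is isomorphic to the quantum generalized Heisenberg algebra $\mathcal{H}_s(rh+\gamma,h)$, where $\alpha=r+s$ and $\beta=-rs$. (2) Conversely, any quantum generalized Heisenberg algebra $\mathcal{H}_q(f,g)$ (with $q\in\mathbb{F}$, $g\in\mathbb{F}[h]$) such that $f(h)=ah+b$ with $a,b\in\mathbb{F}$ is a generalized down-up algebra of the form $L(-g,a,q,-b)$.
   Context: All algebras are unital associative $\mathbb{F}$-algebras, and isomorphisms are isomorphisms of $\mathbb{F}$-algebras. For $q\in\mathbb{F}$ and $f,g\in\mathbb{F}[h]$, the quantum generalized Heisenberg algebra $\mathcal{H}_q(f,g)$ is the $\mathbb{F}$-algebra generated by $x,y,h$ with defining relations $hx=xf(h)$, $yh=f(h)y$, $yx-qxy=g(h)$. For $\alpha,\beta,\gamma\in\mathbb{F}$, the down-up algebra $A(\alpha,\beta,\gamma)$ is the algebra with generators $d,u$ and defining relations $d^2u=\alpha dud+\beta ud^2+\gamma d$ and $du^2=\alpha udu+\beta u^2d+\gamma u$. For $r,s,\gamma\in\mathbb{F}$ and $v\in\mathbb{F}[h]$, the generalized down-up algebra $L(v,r,s,\gamma)$ is the algebra generated by $d,u,h$ with defining relations $dh-rhd+\gamma d=0$,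 $hu-ruh+\gamma u=0$ and $du-sud+v(h)=0$. *)

(* Defs.v *)
From HB Require Import structures.
From mathcomp Require Import all_boot all_algebra.
From mathcomp Require Import finmap boolp.
From mathcomp.multinomials Require Import monalg.

Set Implicit Arguments.
Unset Strict Implicit.
Unset Printing Implicit Defensive.

Import GRing.Theory.
Local Open Scope ring_scope.
Local Open Scope quotient_scope.

Section FreeAlgebra.
Variables (K : fieldType) (n : nat).

Definition free_alg := {malg K[{fmonom 'I_n}]}.

HB.instance Definition _ := GRing.Lalgebra.on free_alg.

Lemma free_scalerAr (k : K) (x y : free_alg) : k *: (x * y) = x * (k *: y).
Proof.
apply/malgP => m; rewrite mcoeffZ mcoeffMl.
rewrite (mcoeffMlw _ (fsubset_refl _) (msuppZ_le k y)) mulr_sumr.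
apply: eq_bigr => m1 _; rewrite mulr_sumr.
by apply: eq_bigr => m2 _; rewrite mcoeffZ mulrnAr mulrCA.
Qed.

HB.instance Definition _ := GRing.Lalgebra_isAlgebra.Build K free_alg
  free_scalerAr.

Definition gen (i : 'I_n) : free_alg := << fmu i >>.

End FreeAlgebra.

Section PresentedAlgebra.
Variable K : fieldType.

(* The relation r stands for r = 0. *)
Record presentation := Presentation {
  ngens : nat;
  relators : seq (free_alg K ngens)
}.

Variable P : presentation.
Local Notation A := (free_alg K (ngens P)).

Inductive ideal_gen : A -> Prop :=
  | ideal_gen_rel r : r \in relators P -> ideal_gen r
  | ideal_gen0 : ideal_gen 0
  | ideal_genD u v : ideal_gen u -> ideal_gen v -> ideal_gen (u + v)
  | ideal_genMl a u : ideal_gen u -> ideal_gen (a * u)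
  | ideal_genMr a u : ideal_gen u -> ideal_gen (u * a).

Definition rel_ideal : {pred A} := fun u => `[< ideal_gen u >].

Lemma rel_idealP u : reflect (ideal_gen u) (u \in rel_ideal).
Proof. exact: asboolP. Qed.

Lemma rel_ideal_zmod_closed : zmod_closed rel_ideal.
Proof.
split=> [|u v /rel_idealP Iu /rel_idealP Iv]; apply/rel_idealP.
  exact: ideal_gen0.
by rewrite -mulN1r; apply/ideal_genD/ideal_genMl.
Qed.

HB.instance Definition _ := GRing.isZmodClosed.Build A rel_ideal
  rel_ideal_zmod_closed.

Definition presented_alg : Type := Quotient.quot rel_ideal.

HB.instance Definition _ := GRing.Zmodule.on presented_alg.
HB.instance Definition _ := EqQuotient.on presented_alg.
HB.instance Definition _ := ZmodQuotient.on presented_alg.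

Local Notation Q := presented_alg.

Lemma pi_eqP (u v : A) : reflect (\pi_Q u = \pi_Q v) (u - v \in rel_ideal).
Proof. by rewrite Quotient.idealrBE; apply: eqP. Qed.

Definition palg_one : Q := \pi_Q 1.
Definition palg_mul := lift_op2 Q *%R.
Definition palg_scale (k : K) := lift_op1 Q ( *:%R k).

Lemma palgW (a : Q) : {u : A | a = \pi_Q u}.
Proof. by exists (repr a); rewrite reprK. Qed.

Lemma reprB (u : A) : ideal_gen (u - repr (\pi_Q u)).
Proof. by apply/rel_idealP/pi_eqP; rewrite reprK. Qed.

Lemma palg_mulE (u v : A) : \pi_Q (u * v) = palg_mul (\pi u) (\pi v).
Proof.
rewrite /palg_mul; unlock; apply/pi_eqP/rel_idealP.
rewrite -[u * v](addrNK (u * repr (\pi_Q v))) -mulrBr -addrA -mulrBl.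
by apply: ideal_genD; [apply/ideal_genMl/reprB | apply/ideal_genMr/reprB].
Qed.

Lemma palg_scaleE (k : K) (u : A) : \pi_Q (k *: u) = palg_scale k (\pi u).
Proof.
rewrite /palg_scale; unlock; apply/pi_eqP/rel_idealP.
rewrite -scalerBr -[u - _]mul1r scalerAl.
exact/ideal_genMl/reprB.
Qed.

Lemma palg_mulA : associative palg_mul.
Proof.
move=> a b c; have [u ->] := palgW a; have [v ->] := palgW b.
by have [w ->] := palgW c; rewrite -!palg_mulE mulrA.
Qed.

Lemma palg_mul1 : left_id palg_one palg_mul.
Proof. by move=> a; have [u ->] := palgW a; rewrite -palg_mulE mul1r. Qed.

Lemma palg_mulr1 : right_id palg_one palg_mul.
Proof. by move=> a; have [u ->] := palgW a; rewrite -palg_mulE mulr1. Qed.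

Lemma palg_mulDl : left_distributive palg_mul +%R.
Proof.
move=> a b c; have [u ->] := palgW a; have [v ->] := palgW b.
have [w ->] := palgW c.
by rewrite -[_ + _](raddfD \pi_Q) -!palg_mulE mulrDl raddfD.
Qed.

Lemma palg_mulDr : right_distributive palg_mul +%R.
Proof.
move=> a b c; have [u ->] := palgW a; have [v ->] := palgW b.
have [w ->] := palgW c.
by rewrite -[_ + _](raddfD \pi_Q) -!palg_mulE mulrDr raddfD.
Qed.

HB.instance Definition _ := GRing.Zmodule_isPzRing.Build Q
  palg_mulA palg_mul1 palg_mulr1 palg_mulDl palg_mulDr.

Lemma palg_scaleA k l a : palg_scale k (palg_scale l a) = palg_scale (k * l) a.
Proof. by have [u ->] := palgW a; rewrite -!palg_scaleE scalerA. Qed.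

Lemma palg_scale1 : left_id 1 palg_scale.
Proof. by move=> a; have [u ->] := palgW a; rewrite -palg_scaleE scale1r. Qed.

Lemma palg_scaleDr : right_distributive palg_scale +%R.
Proof.
move=> k a b; have [u ->] := palgW a; have [v ->] := palgW b.
by rewrite -[_ + _](raddfD \pi_Q) -!palg_scaleE scalerDr raddfD.
Qed.

Lemma palg_scaleDl a : {morph palg_scale^~ a : k l / k + l}.
Proof.
by move=> k l; have [u ->] := palgW a; rewrite -!palg_scaleE scalerDl raddfD.
Qed.

HB.instance Definition _ := GRing.Zmodule_isLmodule.Build K Q
  palg_scaleA palg_scale1 palg_scaleDr palg_scaleDl.

Lemma palg_piM (u v : A) : \pi_Q (u * v) = \pi_Q u * \pi_Q v.
Proof. exact: palg_mulE. Qed.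

Lemma palg_piZ (k : K) (u : A) : \pi_Q (k *: u) = k *: \pi_Q u.
Proof. exact: palg_scaleE. Qed.

(* The last two axioms of a K-algebra. The library's algType also requires     *)
(* 1 != 0, which need not hold for an arbitrary presentation.                  *)
Lemma palg_scalerAl (k : K) (a b : Q) : k *: (a * b) = (k *: a) * b.
Proof.
have [u ->] := palgW a; have [v ->] := palgW b.
by rewrite -palg_piZ -!palg_piM -palg_piZ scalerAl.
Qed.

Lemma palg_scalerAr (k : K) (a b : Q) : k *: (a * b) = a * (k *: b).
Proof.
have [u ->] := palgW a; have [v ->] := palgW b.
by rewrite -palg_piZ -!palg_piM -palg_piZ scalerAr.
Qed.

End PresentedAlgebra.

Coercion presented_alg : presentation >-> Sortclass.

Definition alg_isomorphic (K : fieldType) (P Q : presentation K) : Prop :=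
  exists phi : {rmorphism P -> Q},
    scalable phi /\ bijective phi.

Section Algebras.
Variable K : fieldType.

Definition qgHeisenberg (q : K) (f g : {poly K}) : presentation K :=
  let x : free_alg K 3 := gen K (inord 0) in
  let y : free_alg K 3 := gen K (inord 1) in
  let h : free_alg K 3 := gen K (inord 2) in
  Presentation
    [:: h * x - x * horner_alg h f;
        y * h - horner_alg h f * y;
        y * x - q *: (x * y) - horner_alg h g].

Definition down_up (alpha beta gamma : K) : presentation K :=
  let d : free_alg K 2 := gen K (inord 0) in
  let u : free_alg K 2 := gen K (inord 1) in
  Presentation
    [:: d ^+ 2 * u
          - (alpha *: (d * u * d) + beta *: (u * d ^+ 2) + gamma *: d);
        d * u ^+ 2
          - (alpha *: (u * d * u) + beta *: (u ^+ 2 * d) + gamma *: u)].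

Definition gen_down_up (v : {poly K}) (r s gamma : K) : presentation K :=
  let d : free_alg K 3 := gen K (inord 0) in
  let u : free_alg K 3 := gen K (inord 1) in
  let h : free_alg K 3 := gen K (inord 2) in
  Presentation
    [:: d * h - r *: (h * d) + gamma *: d;
        h * u - r *: (u * h) + gamma *: u;
        d * u - s *: (u * d) + horner_alg h v].

End Algebras.

(* Main.v *)
Require Import Defs.
From mathcomp Require Import all_boot all_algebra.
From HB Require Import structures.
From mathcomp.multinomials Require Import monalg.
Set Implicit Arguments.
Unset Strict Implicit.
Unset Printing Implicit Defensive.
Import GRing.Theory.
Local Open Scope ring_scope.

(** Both kinds of algebras are given by generators and relations, so an
    isomorphism is found by translating generators in both directions: it
    suffices that each translation sends the relators of its source into the
    ideal of its target, and that the two round trips fix every generator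
    modulo the relations. This criterion is [alg_isomorphic_of_gens]; it rests
    on the universal property of the free algebra ([free_lift]), since a map
    of free algebras that respects the relators descends to the quotients.

    For L(v, r, s, gamma) and H_s(rh - gamma, - v) the translation is
    d <-> y, u <-> x, h <-> h. With f(h) = rh - gamma, the relations
    yh = f(h)y, hx = xf(h) and yx - sxy = - v(h), once expanded, are the three
    relations of L, so each set of relators is sent onto the other. An
    affine f(h) = ah + b is the case r = a, gamma = - b, whence the converse
    by symmetry.

    For A(r + s, - rs, gamma), the third relation yx - sxy = h of
    H_s(rh + gamma, h) says that h is redundant: it is sent to du - sud.
    Substituting this for h in dh - (rh + gamma)d gives
    d^2 u - (r + s) dud + rs ud^2 - gamma d, the first down-up relator, and
    hu - u(rh + gamma) gives the second in the same way
    ([down_up_relator_d], [down_up_relator_u]). Conversely the down-up relators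
    at d = y, u = x belong to the ideal of the Heisenberg relators, as the
    explicit combinations of [down_up_relators_combination] show. *)

(** * Homomorphisms out of a free algebra *)

Section FreeAlgebraUniversal.
Variables (K : fieldType) (n : nat).

(** A free algebra is the only subalgebra of itself that contains the
    generators. Two homomorphisms that agree on generators are compared by this
    principle. *)
Lemma free_alg_ind (S : free_alg K n -> Prop) :
    S 1 -> (forall i, S (gen K i)) ->
    (forall u v, S u -> S v -> S (u + v)) ->
    (forall u v, S u -> S v -> S (u * v)) ->
    (forall c u, S u -> S (c *: u)) ->
  forall u, S u.
Proof.
move=> S1 Sgen SD SM SZ u.
have S0 : S 0 by rewrite -(scale0r 1); apply: SZ.
have Smon s : S (<< FMonom s >> : free_alg K n).
  elim: s => [|i s IHs]; first by rewrite -fmoneE; exact: S1.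
  have -> : << FMonom (i :: s) >> = gen K i * << FMonom s >>.
    rewrite /gen malgM_def fgmulUU mulr1; congr << 1 *g _ >>.
    by apply/val_inj; rewrite [RHS]fmM fmU.
  exact: SM (Sgen i) IHs.
rewrite (monalgE u); apply: (big_ind S) => // -[s] _.
have -> : << u@_(FMonom s) *g FMonom s >> = u@_(FMonom s) *: << FMonom s >>.
  by apply/malgP => m; rewrite mcoeffZ !mcoeffU mulrnAr mulr1.
exact/SZ/Smon.
Qed.

Variables (A : algType K) (w : 'I_n -> A).

Definition word_val (m : {fmonom 'I_n}) : A := \prod_(i <- m) w i.

Fact word_val_mmorphism : mmorphism word_val.
Proof.
by split=> [m1 m2|]; rewrite /word_val ?fmM ?big_cat // fm1 big_nil.
Qed.

HB.instance Definition _ := isMultiplicative.Build _ _ word_val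
  word_val_mmorphism.

End FreeAlgebraUniversal.

(** The homomorphism determined by the images [w i] of the generators. It is
    locked, like [proj] below: otherwise a failed comparison of two of its
    values unfolds the whole construction of the algebras. *)
HB.lock Definition free_lift (K : fieldType) (n : nat) (A : algType K)
    (w : 'I_n -> A) : free_alg K n -> A :=
  mmap (in_alg A) (word_val w).

Section FreeLift.
Variables (K : fieldType) (n : nat) (A : algType K) (w : 'I_n -> A).
Local Notation free_lift := (free_lift w).

Fact free_lift_additive : zmod_morphism free_lift.
Proof. by rewrite free_lift.unlock; apply: mmap_is_additive. Qed.
HB.instance Definition _ := GRing.isZmodMorphism.Build _ _ free_lift
  free_lift_additive.

Fact free_lift_monoid_morphism : monoid_morphism free_lift.
Proof.
rewrite free_lift.unlock.
have [|fM f1] := @commr_mmap_is_multiplicative _ _ _ (in_alg A) (word_val w).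
  by move=> u m m'; rewrite /GRing.comm /= mulr_algl mulr_algr.
by split.
Qed.
HB.instance Definition _ := GRing.isMonoidMorphism.Build _ _ free_lift
  free_lift_monoid_morphism.

Fact free_lift_scalable : scalable free_lift.
Proof. by move=> c u; rewrite free_lift.unlock mmapZ mulr_algl. Qed.
HB.instance Definition _ := GRing.isScalable.Build _ _ _ _ free_lift
  free_lift_scalable.

Lemma free_lift0 : free_lift 0 = 0. Proof. exact: raddf0. Qed.
Lemma free_lift1 : free_lift 1 = 1. Proof. exact: rmorph1. Qed.
Lemma free_liftD : {morph free_lift : u v / u + v}. Proof. exact: raddfD. Qed.
Lemma free_liftB : {morph free_lift : u v / u - v}. Proof. exact: raddfB. Qed.
Lemma free_liftM : {morph free_lift : u v / u * v}. Proof. exact: rmorphM. Qed.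
Lemma free_liftZ c : {morph free_lift : u / c *: u}. Proof. exact: linearZ. Qed.

Lemma free_lift_gen i : free_lift (gen K i) = w i.
Proof.
by rewrite free_lift.unlock mmapU /= scale1r mul1r /word_val fmU big_seq1.
Qed.

End FreeLift.

Lemma lrmorph_horner_alg (K : fieldType) (A B : algType K)
    (f : {lrmorphism A -> B}) (a : A) (p : {poly K}) :
  f (horner_alg a p) = horner_alg (f a) p.
Proof.
elim/poly_ind: p => [|p c IHp]; first by rewrite !rmorph0.
by rewrite !rmorphD !rmorphM /= IHp !horner_algX !horner_algC rmorph_alg.
Qed.

(** * The quotient map of a presentation *)

(** A presented algebra may be zero, hence is not an [algType]. The canonical
    map is therefore made a ring morphism and a linear map separately, and
    computations take place in free algebras, before projecting. *)
HB.lock Definition proj (K : fieldType) (P : presentation K)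
    (u : free_alg K (ngens P)) : P := \pi_P%qT u.

Section Projection.
Variables (K : fieldType) (P : presentation K).
Local Notation proj := (@proj K P).

Fact proj_additive : zmod_morphism proj.
Proof. by move=> u v; rewrite proj.unlock [LHS]raddfB. Qed.
HB.instance Definition _ := GRing.isZmodMorphism.Build _ _ proj proj_additive.

Fact proj_monoid_morphism : monoid_morphism proj.
Proof. by split=> [|u v]; rewrite proj.unlock // palg_piM. Qed.
HB.instance Definition _ := GRing.isMonoidMorphism.Build _ _ proj
  proj_monoid_morphism.

Fact proj_scalable : scalable proj.
Proof. by move=> c u; rewrite proj.unlock palg_piZ. Qed.
HB.instance Definition _ := GRing.isScalable.Build _ _ _ _ proj proj_scalable.

Lemma proj1 : proj 1 = 1. Proof. exact: rmorph1. Qed.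
Lemma projD : {morph proj : u v / u + v}. Proof. exact: raddfD. Qed.
Lemma projB : {morph proj : u v / u - v}. Proof. exact: raddfB. Qed.
Lemma projM : {morph proj : u v / u * v}. Proof. exact: rmorphM. Qed.
Lemma projZ c : {morph proj : u / c *: u}. Proof. exact: linearZ. Qed.

Lemma proj_surj (a : P) : exists u, a = proj u.
Proof. by have [u ->] := palgW a; exists u; rewrite proj.unlock. Qed.

Lemma proj_eq u v : ideal_gen (u - v) -> proj u = proj v.
Proof. by move=> Iuv; rewrite proj.unlock; apply/pi_eqP/rel_idealP. Qed.

End Projection.

(** * Isomorphisms of presented algebras *)

Lemma alg_isomorphic_sym (K : fieldType) (P Q : presentation K) :
  alg_isomorphic P Q -> alg_isomorphic Q P.
Proof.
case=> phi [phiZ [psi phiK psiK]].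
have psiD : zmod_morphism psi.
  by move=> a b; apply: (can_inj phiK); rewrite rmorphB !psiK.
have psiM : monoid_morphism psi.
  split=> [|a b]; apply: (can_inj phiK); first by rewrite rmorph1 psiK.
  by rewrite rmorphM !psiK.
pose mD := GRing.isZmodMorphism.Build _ _ psi psiD.
pose mM := GRing.isMonoidMorphism.Build _ _ psi psiM.
pose psiR : {rmorphism Q -> P} := HB.pack psi mD mM.
exists psiR; split; last by exists phi.
by move=> c a; apply: (can_inj phiK); rewrite phiZ !psiK.
Qed.

Section PresentedLift.
Variables (K : fieldType) (P Q : presentation K).
Variable w : 'I_(ngens P) -> free_alg K (ngens Q).
Hypothesis w_rel :
  {in [seq free_lift w r | r <- relators P], forall t, ideal_gen t}.

Lemma free_lift_ideal u : ideal_gen u -> ideal_gen (free_lift w u).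
Proof.
elim=> {u} [r Pr||u v _ IHu _ IHv|a u _ IHu|u a _ IHu].
- by apply/w_rel/map_f.
- by rewrite free_lift0; apply: ideal_gen0.
- by rewrite free_liftD; apply: ideal_genD.
- by rewrite free_liftM; apply: ideal_genMl.
- by rewrite free_liftM; apply: ideal_genMr.
Qed.

(** The choice of [repr a] is immaterial because [free_lift w] sends the ideal
    of [P] into that of [Q]: this is [presented_lift_proj], through which all
    the properties of the map are obtained. *)
Definition presented_lift (a : P) : Q := proj (free_lift w (repr a)).

Lemma presented_lift_proj u : presented_lift (proj u) = proj (free_lift w u).
Proof.
apply/esym/proj_eq; rewrite -free_liftB; apply: free_lift_ideal.
by rewrite proj.unlock; apply: reprB.
Qed.

Fact presented_lift_additive : zmod_morphism presented_lift.
Proof.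
move=> a b; have [u ->] := proj_surj a; have [v ->] := proj_surj b.
by rewrite -projB !presented_lift_proj free_liftB projB.
Qed.

Fact presented_lift_monoid_morphism : monoid_morphism presented_lift.
Proof.
split=> [|a b].
  by rewrite -proj1 presented_lift_proj free_lift1 proj1.
have [u ->] := proj_surj a; have [v ->] := proj_surj b.
by rewrite -projM !presented_lift_proj free_liftM projM.
Qed.

Fact presented_lift_scalable : scalable presented_lift.
Proof.
move=> c a; have [u ->] := proj_surj a.
by rewrite -projZ !presented_lift_proj free_liftZ projZ.
Qed.

End PresentedLift.

(** Two homomorphisms out of [P] that agree on generators agree, so a round trip
    that fixes the generators is the identity. *)
Lemma presented_liftK (K : fieldType) (P Q : presentation K)
    (w : 'I_(ngens P) -> free_alg K (ngens Q))
    (w' : 'I_(ngens Q) -> free_alg K (ngens P)) :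
    {in [seq free_lift w r | r <- relators P], forall t, ideal_gen t} ->
    {in [seq free_lift w' r | r <- relators Q], forall t, ideal_gen t} ->
    (forall i, proj (free_lift w' (w i)) = proj (gen K i) :> P) ->
  cancel (presented_lift w) (presented_lift w').
Proof.
move=> w_rel w'_rel w'w a; have [u ->] := proj_surj a.
rewrite !presented_lift_proj //.
elim/free_alg_ind: u => [|i|u v IHu IHv|u v IHu IHv|c u IHu].
- by rewrite !free_lift1.
- by rewrite free_lift_gen.
- by rewrite [free_lift w _]free_liftD free_liftD 2!projD IHu IHv.
- rewrite [free_lift w _]free_liftM free_liftM.
  by rewrite [in RHS]projM (@projM _ P) IHu IHv.
- rewrite [free_lift w _]free_liftZ free_liftZ.
  by rewrite [in RHS]projZ (@projZ _ P) IHu.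
Qed.

(** The criterion for isomorphism: the hypotheses only concern the images of the
    relators and of the generators, that is, finitely many elements. *)
Lemma alg_isomorphic_of_gens (K : fieldType) (P Q : presentation K)
    (w : 'I_(ngens P) -> free_alg K (ngens Q))
    (w' : 'I_(ngens Q) -> free_alg K (ngens P)) :
    {in [seq free_lift w r | r <- relators P], forall t, ideal_gen t} ->
    {in [seq free_lift w' r | r <- relators Q], forall t, ideal_gen t} ->
    (forall i, proj (free_lift w' (w i)) = proj (gen K i) :> P) ->
    (forall j, proj (free_lift w (w' j)) = proj (gen K j) :> Q) ->
  alg_isomorphic P Q.
Proof.
move=> w_rel w'_rel w'w ww'.
pose mD := GRing.isZmodMorphism.Build _ _ _ (presented_lift_additive w_rel).
pose mM := GRing.isMonoidMorphism.Build _ _ _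
  (presented_lift_monoid_morphism w_rel).
pose phi : {rmorphism P -> Q} := HB.pack (presented_lift w) mD mM.
exists phi; split; first exact: presented_lift_scalable.
by exists (presented_lift w'); apply: presented_liftK.
Qed.

(** * The defining relations for an affine polynomial *)

Section AffineRelators.
Variables (K : fieldType) (A : algType K).
Implicit Types (a b r s c : K) (d u h x y : A) (v : {poly K}).

Lemma horner_alg_affine a b h :
  horner_alg h (a *: 'X + b%:P) = a *: h + b *: 1.
Proof. by rewrite rmorphD /= linearZ /= horner_algX horner_algC mulr_algl. Qed.

Lemma mul_affinel a b h y :
  horner_alg h (a *: 'X + b%:P) * y = a *: (h * y) + b *: y.
Proof. by rewrite horner_alg_affine mulrDl -!scalerAl mul1r. Qed.

Lemma mul_affiner a b h x :
  x * horner_alg h (a *: 'X + b%:P) = a *: (x * h) + b *: x.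
Proof. by rewrite horner_alg_affine mulrDr -!scalerAr mulr1. Qed.

(** If [L] and [R] are left and right multiplication by [d], which commute, then
    the right-hand side is (L - r R)(L - s R) u - c d because
    X^2 - (r + s) X + rs = (X - r)(X - s), and (L - s R) u is [h]. In the next
    lemma the same factorization is applied to [d], with the multiplications by
    [u] in opposite order. *)
Lemma down_up_relator_d r s c d u : let h := d * u - s *: (u * d) in
  d * h - horner_alg h (r *: 'X + c%:P) * d =
  d ^+ 2 * u - ((r + s) *: (d * u * d) + (- (r * s)) *: (u * d ^+ 2) + c *: d).
Proof.
move=> h; rewrite mul_affinel /h mulrBr mulrBl -!scalerAr -!scalerAl.
rewrite scalerBr scalerDl scaleNr -scalerA !expr2 !mulrA.
rewrite -[LHS]addrA -opprD; congr (_ - _).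
by rewrite !addrA [s *: _ + _]addrC.
Qed.

Lemma down_up_relator_u r s c d u : let h := d * u - s *: (u * d) in
  h * u - u * horner_alg h (r *: 'X + c%:P) =
  d * u ^+ 2 - ((r + s) *: (u * d * u) + (- (r * s)) *: (u ^+ 2 * d) + c *: u).
Proof.
move=> h; rewrite mul_affiner /h mulrBr mulrBl -!scalerAr -!scalerAl.
rewrite scalerBr scalerDl scaleNr -scalerA !expr2 !mulrA.
rewrite -[LHS]addrA -opprD; congr (_ - _).
by rewrite !addrA [s *: _ + _]addrC.
Qed.

End AffineRelators.

(** * Relators at arbitrary elements of an algebra *)

Section Relators.
Variables (K : fieldType) (A : algType K).
Implicit Types (q r s a b c : K) (f g v : {poly K}) (x y h d u : A).

(** The relators of the presentations are the cases in which the arguments are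
    the generators of a free algebra; as expressions in arbitrary elements they
    are carried along by homomorphisms. *)
Definition Heisenberg_relators q f g x y h : seq A :=
  [:: h * x - x * horner_alg h f; y * h - horner_alg h f * y;
      y * x - q *: (x * y) - horner_alg h g].

Definition gen_down_up_relators v r s c d u h : seq A :=
  [:: d * h - r *: (h * d) + c *: d; h * u - r *: (u * h) + c *: u;
      d * u - s *: (u * d) + horner_alg h v].

Definition down_up_relators a b c d u : seq A :=
  [:: d ^+ 2 * u - (a *: (d * u * d) + b *: (u * d ^+ 2) + c *: d);
      d * u ^+ 2 - (a *: (u * d * u) + b *: (u ^+ 2 * d) + c *: u)].

(** The relations of the two algebras for d = y and u = x differ only in their
    order: the generalized down-up relations begin with the one between [d] and
    [h]. *)
Lemma Heisenberg_affine_relators r s c v x y h :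
  Heisenberg_relators s (r *: 'X - c%:P) (- v) x y h =i
  gen_down_up_relators v r s c y x h.
Proof.
move=> t; rewrite /Heisenberg_relators /gen_down_up_relators.
rewrite -polyCN mul_affinel mul_affiner rmorphN /= opprK.
by rewrite !scaleNr !opprD !opprK !addrA !inE orbCA.
Qed.

Fact subr_exchange (V : zmodType) (a b c p q : V) :
  a - (b + c) = p - (q + c) + (a - p - (b - q)).
Proof.
have -> : a - p - (b - q) = (a - b) - (p - q).
  by rewrite !opprB addrACA (addrC (- p)) -addrACA.
rewrite [RHS]addrC !opprD 2!(addrA _ _ (- c)) addrA.
by rewrite -[- p - - q]opprD subrK.
Qed.

(** Adding to a commutation relation of [h] the multiples of the relation
    yx - sxy = h that replace every [h] by yx - sxy gives a down-up relation. *)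
Lemma down_up_relators_combination r s c x y h :
  let R := Heisenberg_relators s (r *: 'X + c%:P) 'X x y h in
  down_up_relators (r + s) (- (r * s)) c y x =
  [:: R`_1 + (y * R`_2 - r *: (R`_2 * y));
      R`_0 + (R`_2 * x - r *: (x * R`_2))].
Proof.
rewrite /Heisenberg_relators /= horner_algX /down_up_relators.
rewrite -down_up_relator_d -down_up_relator_u !mul_affinel !mul_affiner.
move: (y * x - _) => k; rewrite !mulrBr !mulrBl !scalerBr.
by congr [:: _; _]; apply: subr_exchange.
Qed.

(** [S] stands for membership in a two-sided ideal. *)
Lemma down_up_relators_ideal (S : A -> Prop) r s c x y h :
    (forall t t', S t -> S t' -> S (t + t')) ->
    (forall d t, S t -> S (d * t)) -> (forall d t, S t -> S (t * d)) ->
    {in Heisenberg_relators s (r *: 'X + c%:P) 'X x y h, forall t, S t} ->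
  {in down_up_relators (r + s) (- (r * s)) c y x, forall t, S t}.
Proof.
move=> SD SMl SMr SR t.
have SZN a u : S u -> S (- (a *: u)).
  by move=> Su; rewrite -scaleNr -mulr_algl; apply: SMl.
have {}SR i : (i < 3)%N ->
    S (Heisenberg_relators s (r *: 'X + c%:P) 'X x y h)`_i.
  by move=> lt_i3; apply/SR/mem_nth.
rewrite (down_up_relators_combination r s c x y h) !in_cons orbF.
have R0 := SR 0%N isT; have R1 := SR 1%N isT; have R2 := SR 2%N isT.
case/orP=> /eqP->.
- exact: (SD _ _ R1 (SD _ _ (SMl y _ R2) (SZN r _ (SMr y _ R2)))).
- exact: (SD _ _ R0 (SD _ _ (SMr x _ R2) (SZN r _ (SMl x _ R2)))).
Qed.

(** The last relator only expresses [h] in terms of [d] and [u]. *)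
Lemma Heisenberg_down_up_relators r s c d u :
  Heisenberg_relators s (r *: 'X + c%:P) 'X u d (d * u - s *: (u * d)) =
  rcons (rev (down_up_relators (r + s) (- (r * s)) c d u)) 0.
Proof.
rewrite /Heisenberg_relators horner_algX subrr.
by rewrite down_up_relator_d down_up_relator_u.
Qed.

End Relators.

(** These are stated for an abstract source: in a free algebra, a failed attempt
    to read a generator as a product is expensive. *)
Section RelatorImages.
Variables (K : fieldType) (A B : algType K) (phi : {lrmorphism A -> B}).

Lemma lrmorph_q_commutator s d u :
  phi (d * u - s *: (u * d)) = phi d * phi u - s *: (phi u * phi d).
Proof. by rewrite rmorphB /= linearZ /= !rmorphM. Qed.

Lemma map_Heisenberg_relators q f g x y h :
  map phi (Heisenberg_relators q f g x y h) =
  Heisenberg_relators q f g (phi x) (phi y) (phi h).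
Proof.
rewrite /= !rmorphB /= !linearZ /= !rmorphM /=.
by rewrite !lrmorph_horner_alg !scalerN.
Qed.

Lemma map_gen_down_up_relators v r s c d u h :
  map phi (gen_down_up_relators v r s c d u h) =
  gen_down_up_relators v r s c (phi d) (phi u) (phi h).
Proof.
rewrite /= !rmorphD /= !rmorphN /= !linearZ /= !rmorphM /=.
by rewrite !lrmorph_horner_alg !scalerN.
Qed.

Lemma map_down_up_relators a b c d u :
  map phi (down_up_relators a b c d u) =
  down_up_relators a b c (phi d) (phi u).
Proof.
rewrite /= !rmorphB /= !rmorphD /= !linearZ /= !rmorphM /=.
by [].
Qed.

End RelatorImages.

(** The presentations designate their generators by [inord], so statements about
    all generators are needed in this form. *)
Lemma forall_ord_inord n (S : 'I_n.+1 -> Prop) :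
  (forall k, (k <= n)%N -> S (inord k)) -> forall i, S i.
Proof. by move=> Sin i; rewrite -(inord_val i); apply: Sin; rewrite -ltnS. Qed.

Lemma free_lift_nth (K : fieldType) (A : algType K) n (s : seq A) k :
  (k <= n)%N -> free_lift (fun i : 'I_n.+1 => s`_i) (gen K (inord k)) = s`_k.
Proof. by move=> le_kn; rewrite free_lift_gen inordK. Qed.

Section FreeLiftRelators.
Variables (K : fieldType) (A : algType K).

Lemma free_lift_Heisenberg (q : K) (f g : {poly K}) (x y h : A) :
  [seq free_lift (fun i : 'I_3 => [:: x; y; h]`_i) t
     | t <- relators (qgHeisenberg q f g)] = Heisenberg_relators q f g x y h.
Proof.
by rewrite (map_Heisenberg_relators (free_lift _)); congr Heisenberg_relators;
  apply: free_lift_nth.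
Qed.

Lemma free_lift_gen_down_up (v : {poly K}) (r s c : K) (d u h : A) :
  [seq free_lift (fun i : 'I_3 => [:: d; u; h]`_i) t
     | t <- relators (gen_down_up v r s c)] =
  gen_down_up_relators v r s c d u h.
Proof.
by rewrite (map_gen_down_up_relators (free_lift _)); congr gen_down_up_relators;
  apply: free_lift_nth.
Qed.

Lemma free_lift_down_up (a b c : K) (d u : A) :
  [seq free_lift (fun i : 'I_2 => [:: d; u]`_i) t
     | t <- relators (down_up a b c)] = down_up_relators a b c d u.
Proof.
by rewrite (map_down_up_relators (free_lift _)); congr down_up_relators;
  apply: free_lift_nth.
Qed.

End FreeLiftRelators.

(** * The isomorphisms *)

Section Isomorphisms.
Variable K : fieldType.

(** The exchange of the first two generators is an involution, so it serves in
    both directions. *)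
Lemma gen_down_up_Heisenberg (r s c : K) (v : {poly K}) :
  alg_isomorphic (gen_down_up v r s c)
    (qgHeisenberg s (r *: 'X - c%:P) (- v)).
Proof.
pose w (i : 'I_3) : free_alg K 3 :=
  [:: gen K (inord 1); gen K (inord 0); gen K (inord 2)]`_i.
have wK (i : 'I_3) : free_lift w (w i) = gen K i.
  elim/forall_ord_inord: i => -[|[|[|//]]] _;
    by rewrite {2}/w inordK // free_lift_nth.
apply: (@alg_isomorphic_of_gens _ (gen_down_up _ _ _ _)
  (qgHeisenberg _ _ _) w w) => [t|t|i|i]; [| |by rewrite wK|by rewrite wK].
- rewrite free_lift_gen_down_up -Heisenberg_affine_relators.
  exact: ideal_gen_rel.
- rewrite free_lift_Heisenberg Heisenberg_affine_relators.
  exact: ideal_gen_rel.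
Qed.

(** The generator [h] is sent to du - sud. *)
Lemma down_up_Heisenberg (r s c : K) :
  alg_isomorphic (down_up (r + s) (- (r * s)) c)
    (qgHeisenberg s (r *: 'X + c%:P) 'X).
Proof.
set H := qgHeisenberg _ _ _; set D := down_up _ _ _.
pose x : free_alg K (ngens H) := gen K (inord 0).
pose y : free_alg K (ngens H) := gen K (inord 1).
pose h : free_alg K (ngens H) := gen K (inord 2).
pose d : free_alg K (ngens D) := gen K (inord 0).
pose u : free_alg K (ngens D) := gen K (inord 1).
pose w (i : 'I_2) : free_alg K (ngens H) := [:: y; x]`_i.
pose w' (i : 'I_3) : free_alg K (ngens D) :=
  [:: u; d; d * u - s *: (u * d)]`_i.
apply: (@alg_isomorphic_of_gens _ D H w w').
- rewrite free_lift_down_up; apply: (@down_up_relators_ideal _ _ _ r s c x y h).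
  + exact: ideal_genD.
  + exact: ideal_genMl.
  + exact: ideal_genMr.
  + exact: ideal_gen_rel.
- rewrite free_lift_Heisenberg Heisenberg_down_up_relators => t.
  rewrite mem_rcons in_cons mem_rev => /orP[/eqP->|]; first exact: ideal_gen0.
  exact: ideal_gen_rel.
- by elim/forall_ord_inord => -[|[|//]] _;
    rewrite /w inordK // free_lift_nth.
- elim/forall_ord_inord => -[|[|[|//]]] _; rewrite /w' inordK //.
  + by rewrite free_lift_nth.
  + by rewrite free_lift_nth.
  + have wd : free_lift w d = y by apply: free_lift_nth.
    have wu : free_lift w u = x by apply: free_lift_nth.
    rewrite [X in proj X](lrmorph_q_commutator (free_lift w)) [X in proj X]/=.
    rewrite wd wu; apply: proj_eq.
    have : ideal_gen (y * x - s *: (x * y) - horner_alg h 'X).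
      exact: (ideal_gen_rel (@mem_nth _ 0 (relators H) 2 isT)).
    by rewrite horner_algX.
Qed.

End Isomorphisms.

Theorem proposition1p3 (K : fieldType) :
  [/\ forall (r s gamma : K) (v : {poly K}),
        alg_isomorphic (gen_down_up v r s gamma)
          (qgHeisenberg s (r *: 'X - gamma%:P) (- v)),
      forall alpha beta gamma r s : K,
        alpha = r + s -> beta = - (r * s) ->
        alg_isomorphic (down_up alpha beta gamma)
          (qgHeisenberg s (r *: 'X + gamma%:P) 'X)
    & forall (q : K) (f g : {poly K}) (a b : K),
        f = a *: 'X + b%:P ->
        alg_isomorphic (qgHeisenberg q f g) (gen_down_up (- g) a q (- b))].
Proof.
split=> [r s c v|_ _ c r s -> ->|q _ g a b ->].
- exact: gen_down_up_Heisenberg.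
- exact: down_up_Heisenberg.
- apply: alg_isomorphic_sym; have := gen_down_up_Heisenberg a q (- b) (- g).
  by rewrite polyCN !opprK.
Qed.
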